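(* Let $D\ge 0$, $h,p\in\mathbb{R}_+$, and let $c(y,d)=h[y-d]^++p[d-y]^+$. Given any feasible deterministic algorithm $(Y_t)_{t\in\mathbb{N}}$ for the single-product lost sales newsvendor inventory problem with observable demand over $\mathcal{Y}=[0,D]$, there exists a sequence of demands $(d_t)_{t\in\mathbb{N}}\subset\mathbb{R}_+$ such that the regret $$R_T=\sum_{t=1}^T c(y_t,d_t)-\inf_{y\in[0,D]}\sum_{t=1}^T c(y,d_t),\qquad y_t=Y_t(d_1,\dots,d_{t-1}),$$ is linear, i.e. $R_T=\Theta(T)$.
   Context: $\mathbb{N}=\{1,2,\dots\}$, $\mathbb{R}_+=[0,\infty)$, $[v]^+=\max\{v,0\}$. Single-product lost sales newsvendor inventory problem with observable demand over $[0,D]$: the inventory starts at $x_1=0$; at each period $t\in\mathbb{N}$ the manager observes the inventory state $x_t$, picks an order-up-to level $y_t\in[0,D]$ subject to the feasibility constraint $y_t\ge x_t$, suffers the newsvendor loss $\ell_t(y_t)=c(y_t,d_t)$, observes the demand $d_t\in\mathbb{R}_+$, and the inventory is updated by $x_{t+1}=[y_t-d_t]^+$. Here $h\in\mathbb{R}_+$ is the unit holding cost and $p\in\mathbb{R}_+$ the unit lost sales penalty cost. A deterministic algorithm is a sequence of fixed-in-advance functions $Y_t:\mathbb{R}_+^{t-1}\to[0,D]$ ($Y_1$ being a constant), which outputs $y_t=Y_t(d_1,\dots,d_{t-1})$. It is feasible if $Y_{t+1}(d_1,\dots,d_t)\ge[Y_t(d_1,\dots,d_{t-1})-d_t]^+$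 for all $t\in\mathbb{N}$ and all $d_1,\dots,d_t\in\mathbb{R}_+$. $R_T=\Theta(T)$ means: there exist constants $0<a\le b$ and $T_0\in\mathbb{N}$ such that $aT\le R_T\le bT$ for all $T\ge T_0$.
   Formalization: The formal theorem assumes D > 0, h > 0 and p > 0 instead of D ≥ 0 and h, p ≥ 0; if D = 0, or p = 0 with Y_t = 0, or h = 0 with Y_t = D, the regret is identically 0 for all demands, so the claim fails. *)

(* Defs.v *)
(* MathComp / MathComp-Analysis, over an arbitrary real number type R. *)
From mathcomp Require Import all_boot all_order all_algebra.
From mathcomp Require Import interval_inference boolp classical_sets
  set_interval reals.

Set Implicit Arguments.
Unset Strict Implicit.
Unset Printing Implicit Defensive.

Import Order.TTheory GRing.Theory Num.Theory.

Local Open Scope classical_set_scope.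
Local Open Scope ring_scope.

Definition pospart (R : realType) (v : R) : R := Num.max v 0.

Definition newsvendor_cost (R : realType) (h p y d : R) : R :=
  h * pospart (y - d) + p * pospart (d - y).

(* Periods are numbered from 0: [Y t] is the order-up-to level of the
   (t+1)-st period, as a function of the t demands observed before it, listed
   chronologically, and [d t] is the demand of the (t+1)-st period. *)
Definition policy (R : realType) := forall t : nat, t.-tuple {nonneg R} -> R.

Definition takes_values_in (R : realType) (D : R) (Y : policy R) : Prop :=
  forall (t : nat) (s : t.-tuple {nonneg R}), 0 <= Y t s <= D.

Definition feasible (R : realType) (Y : policy R) : Prop :=
  forall (t : nat) (s : t.-tuple {nonneg R}) (x : {nonneg R}),
    pospart (Y t s - x%:num) <= Y t.+1 [tuple of rcons s x].

Definition play (R : realType) (Y : policy R) (d : nat -> {nonneg R})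
    (t : nat) : R :=
  Y t [tuple d i | i < t].

Definition regret (R : realType) (D h p : R) (Y : policy R)
    (d : nat -> {nonneg R}) (T : nat) : R :=
  \sum_(t < T) newsvendor_cost h p (play Y d t) (d t)%:num
  - inf [set \sum_(t < T) newsvendor_cost h p y (d t)%:num | y in `[0, D]].

(* [u T = Theta(T)], with signed two-sided bounds: the library's [=Theta_]
   compares norms, so it would also accept a regret tending to -oo. *)
Definition linear_growth (R : realType) (u : nat -> R) : Prop :=
  exists a b : R, [/\ 0 < a, a <= b &
    exists T0 : nat, forall T : nat, (T0 <= T)%N ->
      a * T%:R <= u T <= b * T%:R].

(* Main.v *)
(* Feed the algorithm the demand D until it first orders a positive level v.
   If it never does, it pays p D per period while the level D costs nothing.
   Otherwise switch to zero demand at that moment: the inventory can no longer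
   decrease, so the algorithm pays at least h v per period, while the level 0
   only pays for the finitely many periods of demand D. *)
Require Import Defs.
From mathcomp Require Import all_boot all_order all_algebra.
From mathcomp Require Import interval_inference boolp classical_sets
  set_interval reals.
From mathcomp Require Import lra.

Set Implicit Arguments.
Unset Strict Implicit.
Unset Printing Implicit Defensive.

Import Order.TTheory GRing.Theory Num.Theory.

Local Open Scope ring_scope.

Section Regret.
Variables (R : realType) (D h p : R).
Hypotheses (D_ge0 : 0 <= D) (h_ge0 : 0 <= h) (p_ge0 : 0 <= p).
Implicit Types (y d : R) (Y : policy R) (dem : nat -> {nonneg R}).

Lemma pospart_ge0 y : 0 <= pospart y.
Proof. by rewrite le_max lexx orbT. Qed.

Lemma pospart_id y : 0 <= y -> pospart y = y.
Proof. exact: max_l. Qed.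

Lemma pospart_eq0 y : y <= 0 -> pospart y = 0.
Proof. exact: max_r. Qed.

Lemma newsvendor_cost_ge0 y d : 0 <= newsvendor_cost h p y d.
Proof. by rewrite addr_ge0 ?mulr_ge0 ?pospart_ge0. Qed.

Lemma newsvendor_cost_over y d : d <= y -> newsvendor_cost h p y d = h * (y - d).
Proof.
move=> dy; rewrite /newsvendor_cost pospart_id ?subr_ge0//.
by rewrite pospart_eq0 ?subr_le0// mulr0 addr0.
Qed.

Lemma newsvendor_cost_under y d : y <= d -> newsvendor_cost h p y d = p * (d - y).
Proof.
move=> yd; rewrite /newsvendor_cost pospart_eq0 ?subr_le0//.
by rewrite mulr0 add0r pospart_id ?subr_ge0.
Qed.

Lemma newsvendor_cost_le y d : 0 <= y <= D -> 0 <= d <= D ->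
  newsvendor_cost h p y d <= (h + p) * D.
Proof.
move=> /andP[y0 yD] /andP[d0 dD].
have [dy|/ltW yd] := leP d y; rewrite mulrDl.
  by rewrite newsvendor_cost_over// ler_wpDr ?mulr_ge0// ler_wpM2l//; lra.
by rewrite newsvendor_cost_under// ler_wpDl ?mulr_ge0// ler_wpM2l//; lra.
Qed.

(** Any single level serves as benchmark for a lower bound, since the costs are nonnegative and the
    infimum is therefore below each value. It is used with the levels [D] and [0]. *)
Lemma regret_ge Y dem T y : 0 <= y <= D ->
  \sum_(t < T) newsvendor_cost h p (play Y dem t) (dem t)%:num
  - \sum_(t < T) newsvendor_cost h p y (dem t)%:num <= regret D h p Y dem T.
Proof.
move=> yD; rewrite lerB// ge_inf//.
  by exists 0 => _ [z _ <-]; apply: sumr_ge0 => t _; exact: newsvendor_cost_ge0.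
by exists y => //=; rewrite in_itv.
Qed.

(** Levels and demands in [[0, D]] cap each period's cost, and the subtracted infimum is
    nonnegative. *)
Lemma regret_le Y dem T : takes_values_in D Y ->
  (forall t, (dem t)%:num <= D) -> regret D h p Y dem T <= (h + p) * D * T%:R.
Proof.
move=> YD demD; rewrite /regret lerBlDr.
rewrite (@le_trans _ _ ((h + p) * D * T%:R))//; last first.
  rewrite lerDl lb_le_inf//.
    by eexists; exists 0 => //=; rewrite in_itv/= lexx.
  by move=> _ [z _ <-]; apply: sumr_ge0 => t _; exact: newsvendor_cost_ge0.
rewrite mulr_natr -[leRHS](_ : \sum_(t < T) (h + p) * D = _); last first.
  by rewrite sumr_const card_ord.
by apply: ler_sum => t _; apply: newsvendor_cost_le; [exact: YD|exact/andP].
Qed.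

End Regret.

(** Causality: demands can be altered from period [t] on without changing the order of period
    [t]. *)
Lemma play_eq (R : realType) (Y : policy R) (d e : nat -> {nonneg R}) t :
  (forall i, (i < t)%N -> d i = e i) -> play Y d t = play Y e t.
Proof.
move=> de; congr (Y t _); apply: eq_from_tnth => i.
by rewrite !tnth_mktuple de.
Qed.

Lemma play_feasible (R : realType) (Y : policy R) (d : nat -> {nonneg R}) t :
  feasible Y -> play Y d t - (d t)%:num <= play Y d t.+1.
Proof.
move=> Yf; apply: (@le_trans _ _ (pospart (play Y d t - (d t)%:num))).
  by rewrite le_max lexx.
rewrite [leRHS](_ : _ = Y t.+1 [tuple of rcons [tuple d i | i < t] (d t)]).
  exact: Yf.
(* Both histories are images of integer ranges, and [iota 0 (t + 1)] is [iota 0 t] followed by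
   [t]. *)
congr (Y t.+1 _); apply: val_inj => /=.
rewrite (map_comp d val) (map_comp d val (enum 'I_t)) !val_enum_ord.
by rewrite -addn1 iotaD map_cat cats1.
Qed.

(** With zero demand nothing is sold, so the whole last level is carried over as inventory. *)
Lemma play_nondecreasing (R : realType) (Y : policy R)
    (d : nat -> {nonneg R}) t s : feasible Y ->
  (forall i, (t <= i)%N -> (d i)%:num = 0) -> (t <= s)%N ->
  play Y d t <= play Y d s.
Proof.
move=> Yf d0; elim: s => [|s IHs]; first by rewrite leqn0 => /eqP->.
rewrite leq_eqVlt => /predU1P[->//|]; rewrite ltnS => ts.
by apply: le_trans (IHs ts) _; rewrite -[leLHS]subr0 -(d0 s ts) play_feasible.
Qed.

(** Positivity matters: a constant policy has zero regret if [D = 0], if [p = 0] (order 0) or if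
    [h = 0] (order [D]). *)
Theorem proposition13 (R : realType) (D h p : R)
    (D_gt0 : 0 < D) (h_gt0 : 0 < h) (p_gt0 : 0 < p)
    (Y : policy R) (Y_range : takes_values_in D Y) (Y_feasible : feasible Y) :
  exists d : nat -> {nonneg R}, linear_growth (regret D h p Y d).
Proof.
have D0 := ltW D_gt0; have h0 := ltW h_gt0; have p0 := ltW p_gt0.
have linear_growthW (d : nat -> {nonneg R}) (a : R) T0 :
    0 < a -> (forall t, (d t)%:num <= D) ->
    (forall T, (T0 <= T)%N -> a * T%:R <= regret D h p Y d T) ->
    linear_growth (regret D h p Y d).
  (* The upper slope comes from [regret_le]; adding [a] to it ensures [a <= b]. *)
  move=> a0 dD lb; exists a, (a + (h + p) * D); split => //.
    by rewrite lerDl mulr_ge0// addr_ge0.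
  exists T0 => T TT; rewrite lb//= mulrDl.
  rewrite (le_trans (regret_le D0 h0 p0 _ Y_range dD))//.
  by rewrite lerDr mulr_ge0// ltW.
pose full : nat -> {nonneg R} := fun=> NngNum D0.
have [[t yt]|never] := pselect (exists t, 0 < play Y full t); last first.
  exists full; apply: (linear_growthW _ (p * D) 0%N) => //.
    exact: mulr_gt0.
  move=> T _; apply: le_trans (@regret_ge _ D h p h0 p0 _ _ _ D _); last first.
    by rewrite D0 lexx.
  rewrite -sumrB mulr_natr -[leLHS](_ : \sum_(t < T) p * D = _); last first.
    by rewrite sumr_const card_ord.
  apply: ler_sum => t _ /=.
  have -> : play Y full t = 0.
    have /andP[y0 _] := Y_range t [tuple full i | i < t].
    apply/le_anti; rewrite [X in _ && X]y0 andbT.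
    by rewrite leNgt; apply/negP => yt; apply: never; exists t.
  by rewrite !newsvendor_cost_under// subrr mulr0 !subr0.
set v := play Y full t in yt.
(* Demand is already zero in period [t] itself, whose order [v] depends only on earlier demands. *)
pose d s : {nonneg R} := if (s < t)%N then NngNum D0 else NngNum (lexx 0).
have d0 s : (t <= s)%N -> (d s)%:num = 0 by rewrite /d ltnNge => ->.
have playv s : (t <= s)%N -> v <= play Y d s.
  move=> ts; rewrite /v -(@play_eq _ _ d); last by move=> i; rewrite /d => ->.
  exact: play_nondecreasing.
have hv : 0 < h * v by exact: mulr_gt0.
(* Crediting [h * v] in every period overshoots by [K] in each of the first [t], where the
   difference to level 0 is only known to be at least [- (p * D)]. *)
pose K := h * v + p * D.
(* Half of the slope [h * v] is given up to absorb the total correction [K * t], which the second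
   threshold makes possible; [t <= T] allows the sum to be split at [t]. *)
exists d; apply: (linear_growthW _ (h * v / 2)
  (maxn t (Num.bound (K * t%:R / (h * v / 2))))) => [|s|T].
- by rewrite divr_gt0.
- by rewrite /d; case: ifP.
rewrite geq_max => /andP[tT boundT].
have KT : K * t%:R <= h * v / 2 * T%:R.
  rewrite -ler_pdivrMl ?divr_gt0// [leLHS]mulrC.
  rewrite (le_trans (ltW (archi_boundP _))) ?ler_nat//.
  by rewrite divr_ge0 ?mulr_ge0 ?addr_ge0 ?mulr_ge0// ltW.
apply: le_trans (@regret_ge _ D h p h0 p0 _ _ _ 0 _); last by rewrite lexx.
apply: (@le_trans _ _ (\sum_(s < T) (h * v - if (s < t)%N then K else 0))).
  rewrite sumrB sumr_const card_ord -big_mkcond/=.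
  rewrite -(big_ord_widen T (fun=> K))// sumr_const card_ord.
  by rewrite -[_ *+ T]mulr_natr -[_ *+ t]mulr_natr; lra.
rewrite -sumrB; apply: ler_sum => s _; rewrite /K.
case: ifPn => [st|]; last rewrite -leqNgt => ts.
  (* Before the switch level 0 pays exactly [p * D], and the algorithm's cost is bounded below by
     0. *)
  rewrite [newsvendor_cost _ _ 0 _]newsvendor_cost_under//.
  rewrite /d st /= subr0; have := newsvendor_cost_ge0 h0 p0 (play Y d s) D.
  by rewrite /d; lra.
have vs := playv s ts; rewrite (d0 s ts) !newsvendor_cost_over//.
  by rewrite !subr0 mulr0 subr0 ler_pM2l.
exact: le_trans (ltW yt) vs.
Qed.
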